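(* Let $\mathcal{Z}$ and $\mathcal{Z}'$ be two global cross sections for the action of $\mathcal{G}$ on $\mathcal{X}$ with the same common isotropy subgroup $\mathcal{G}_0$ (notation as in the context). Suppose that $x$ is distributed according to a cross-sectionally contoured distribution $f_{\mathcal{Y}}(y(x))\lambda(dx)$ with respect to $\mathcal{Z}$. Then the distribution of $z'=z'(x)$ is \[ \frac{1}{\Delta(g(z'))}\,\nu_{\mathcal{Z}'}(dz'). \] In addition, $z'=z'(x)$ is distributed independently of $y=y(x)$.
   Context: A group $\mathcal{G}$ acts on a space $\mathcal{X}$ from the left. The isotropy subgroup at $x$ is $\mathcal{G}_x=\{g\in\mathcal{G}: gx=x\}$. A cross section is a subset of $\mathcal{X}$ meeting each orbit $\mathcal{G}x$ in exactly one point; it is a global cross section if the isotropy subgroup is the same at all of its points. Let $\mathcal{Z}$, $\mathcal{Z}'$ be global cross sections with $\mathcal{G}_z=\mathcal{G}_{z'}=\mathcal{G}_0$ for all $z\in\mathcal{Z}$, $z'\in\mathcal{Z}'$. Put $\mathcal{Y}=\mathcal{G}/\mathcal{G}_0$ (left cosets), $\pi:\mathcal{G}\to\mathcal{Y}$, $\pi(g)=g\mathcal{G}_0$. The orbital decomposition with respect to $\mathcal{Z}$ is the bijection $\mathcal{X}\leftrightarrow\mathcal{Y}\times\mathcal{Z}$, $x\leftrightarrow(y(x),z(x))$, where $x=gz(x)$ and $y(x)=\pi(g)$; similarly $x\leftrightarrow(y'(x),z'(x))\in\mathcal{Y}\times\mathcal{Z}'$ is the orbital decomposition with respect to $\mathcal{Z}'$.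 Let $g(x)\in\mathcal{G}$ denote an arbitrary selection of an element of the coset $y(x)$, so $x=g(x)z(x)$. Standing assumptions (measurability means Borel measurability; quotient spaces carry the quotient topology): (1) $\mathcal{X}$ is a locally compact Hausdorff space; (2) $\mathcal{G}$ is a second countable, locally compact Hausdorff topological group acting continuously on $\mathcal{X}$; (3) $\mathcal{G}_0$ is compact; (4) the global cross sections considered are locally compact in the relative topology, and the corresponding orbital decompositions are bimeasurable. $\lambda$ is a measure on $\mathcal{X}$ that is relatively invariant with multiplier $\chi$: $\lambda(d(gx))=\chi(g)\lambda(dx)$, $g\in\mathcal{G}$, where $\chi$ is a continuous homomorphism from $\mathcal{G}$ to the multiplicative group of positive reals. $\mu_{\mathcal{G}}$ is a left Haar measure on $\mathcal{G}$, $\mu_{\mathcal{Y}}=\mu_{\mathcal{G}}\pi^{-1}$, and $\chi(y):=\chi(g)$ for any $g\in\pi^{-1}(\{y\})$. With this same $\mu_{\mathcal{Y}}$, the measure $\lambda$ factors with respect to the two cross sections as $\lambda(dx)=\chi(y)\mu_{\mathcal{Y}}(dy)\nu_{\mathcal{Z}}(dz)$ and $\lambda(dx)=\chi(y')\mu_{\mathcal{Y}}(dy')\nu_{\mathcal{Z}'}(dz')$, where $\nu_{\mathcal{Z}}$ is standardized to be a probability measure on $\mathcal{Z}$ ($\nu_{\mathcal{Z}'}$ need not be a probability measure). $\Delta(g)=\chi(g)\Delta^{\mathcal{G}}(g)$, where $\Delta^{\mathcal{G}}$ is the right-hand modulus: $\mu_{\mathcal{G}}(d(gg_1))=\Delta^{\mathcal{G}}(g_1)\mu_{\mathcal{G}}(dg)$.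 Since $\Delta\equiv 1$ on $\mathcal{G}_0$, $\Delta(g(z'))$ does not depend on the selection. A distribution (probability measure) on $\mathcal{X}$ is cross-sectionally contoured with respect to $\mathcal{Z}$ if it is of the form $f_{\mathcal{Y}}(y(x))\lambda(dx)$ for some function $f_{\mathcal{Y}}$ on $\mathcal{Y}$. *)

(* Defs.v *)
From HB Require Import structures.
From mathcomp Require Import all_boot all_order all_algebra.
From mathcomp Require Import all_classical all_reals all_analysis.

Set Implicit Arguments.
Unset Strict Implicit.
Unset Printing Implicit Defensive.

Import Order.TTheory GRing.Theory Num.Theory.
Import numFieldNormedType.Exports.

Local Open Scope classical_set_scope.
Local Open Scope ring_scope.

Notation borel T := (g_sigma_algebraType (@open T)).

(* The base point inherited from PointedTopological only serves to make Borel
   spaces available (measurable types are pointed); it need not be 1. *)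
HB.mixin Record isTopologicalGroup G of PointedTopological G & Group G := {
  mulg_continuous : continuous (fun p : G * G => (p.1 * p.2)%g) ;
  invg_continuous : continuous (fun g : G => (g^-1)%g) }.

#[short(type="topologicalGroupType")]
HB.structure Definition TopologicalGroup :=
  {G of isTopologicalGroup G & PointedTopological G & Group G}.

Section coset_space.
Local Open Scope quotient_scope.
Variables (G : topologicalGroupType) (H : groupClosed G).

(* g H = h H *)
Definition lcoset_rel : rel G := fun g h => (g^-1 * h)%g \in H.

Lemma lcoset_rel_refl : reflexive lcoset_rel.
Proof. by move=> g; rewrite /lcoset_rel mulVg gpred1. Qed.

Lemma lcoset_rel_sym : symmetric lcoset_rel.
Proof. by move=> g h; rewrite /lcoset_rel -gpredV invgM invgK. Qed.

Lemma lcoset_rel_trans : transitive lcoset_rel.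
Proof.
move=> h g k gh hk; rewrite /lcoset_rel.
by have := gpredM _ _ gh hk; rewrite mulgA mulgK.
Qed.

Canonical lcoset_equiv :=
  EquivRel lcoset_rel lcoset_rel_refl lcoset_rel_sym lcoset_rel_trans.

Definition coset_space := quotient_topology {eq_quot lcoset_equiv}.

Definition lcoset_of (g : G) : coset_space := \pi_coset_space g.

End coset_space.

Section group_measures.
Variables (R : realType) (G : topologicalGroupType).

Definition continuous_character (chi : G -> R) :=
  [/\ continuous chi, forall g, 0 < chi g &
      forall g h, chi (g * h)%g = chi g * chi h].

Local Open Scope ereal_scope.

(* On a second countable locally compact Hausdorff group, a Borel measure that
   is finite on compact sets is automatically regular. *)
Definition left_haar_measure (mu : {measure set (borel G) -> \bar R}) :=
  [/\ forall (g : G) (A : set (borel G)), measurable A ->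
        mu [set (g * h)%g | h in A] = mu A,
      forall K : set G, compact K -> mu K < +oo &
      mu [set: G] != 0].

Definition right_modulus (mu : {measure set (borel G) -> \bar R})
    (D : G -> R) :=
  forall (g : G) (A : set (borel G)), measurable A ->
    mu [set (h * g)%g | h in A] = (D g)%:E * mu A.

End group_measures.

Section actions.
Variables (G : topologicalGroupType) (X : ptopologicalType).
Variable act : G -> X -> X.

Definition continuous_action :=
  [/\ forall x, act 1%g x = x,
      forall g h x, act (g * h)%g x = act g (act h x) &
      continuous (fun p : G * X => act p.1 p.2)].

Definition isotropy (x : X) : set G := [set g | act g x = x].

Definition action_orbit (x : X) : set X := [set act g x | g in [set: G]].

Definition is_cross_section (Z : set X) :=
  forall x, exists! z, (Z `&` action_orbit x) z.

Definition is_global_cross_section (Z : set X) :=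
  is_cross_section Z /\
  forall z1 z2, Z z1 -> Z z2 -> isotropy z1 = isotropy z2.

Record global_cross_section := GlobalCrossSection {
  cross_section_set :> set X ;
  cross_sectionP : is_global_cross_section cross_section_set }.

Lemma cross_section_nonempty (Z : global_cross_section) :
  exists z : set_type Z, True.
Proof.
have [z [[Zz _] _]] := (cross_sectionP Z).1 point.
by exists (SigSub (mem_set Zz)).
Qed.

(* A cross section, as the type set_type Z, carries the relative topology;
   the base point is only needed to make it a measurable type. *)
HB.instance Definition _ (Z : global_cross_section) :=
  isPointed.Build (set_type (cross_section_set Z))
    (projT1 (cid (cross_section_nonempty Z))).

End actions.

Section orbital_decomposition.
Variables (G : topologicalGroupType) (X : ptopologicalType).
Variables (act : G -> X -> X) (G0 : groupClosed G).
Variable Z : global_cross_section act.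

Let Y := coset_space G0.

(* This determines y and z when G0 is the isotropy subgroup along Z. *)
Definition orbital_decomposition (y : X -> Y) (z : X -> Z) :=
  forall x, exists g, x = act g (set_val (z x)) /\ y x = lcoset_of G0 g.

(* Y * Z carries the product of the Borel sigma-algebras, which is the Borel
   sigma-algebra of the product space since Y is second countable. *)
Definition bimeasurable_decomposition (y : X -> Y) (z : X -> Z) :=
  let yz := fun x => (y x, z x) in
  measurable_fun [set: borel X] (yz : borel X -> borel Y * borel Z) /\
  forall A : set (borel X), measurable A ->
    measurable (yz @` A : set (borel Y * borel Z)).

End orbital_decomposition.

Section measures_on_space.
Variables (R : realType) (G : topologicalGroupType) (X : ptopologicalType).
Variables (act : G -> X -> X) (G0 : groupClosed G).

Let Y := coset_space G0.

Local Open Scope ereal_scope.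

Definition relatively_invariant (lambda : {measure set (borel X) -> \bar R})
    (chi : G -> R) :=
  forall (g : G) (A : set (borel X)), measurable A ->
    lambda [set act g x | x in A] = (chi g)%:E * lambda A.

Definition coset_measure (mu : {measure set (borel G) -> \bar R}) :
    set (borel Y) -> \bar R :=
  pushforward mu (lcoset_of G0 : borel G -> borel Y).

(* The choice of the representative is immaterial when chi is a continuous
   character and G0 is compact, since then chi = 1 on G0. *)
Definition on_cosets (chi : G -> R) (y : Y) : R := chi (repr y).

(* lambda(dx) = chi(y) muY(dy) nu(dz), where muY is the image of mu on Y;
   m1 \x^ m2 is the product measure C |-> \int[m2]_z m1 {y | C (y, z)}. *)
Definition factors_along (Z : global_cross_section act)
    (y : X -> Y) (z : X -> Z)
    (lambda : {measure set (borel X) -> \bar R}) (chi : G -> R)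
    (mu : {measure set (borel G) -> \bar R})
    (nu : {measure set (borel Z) -> \bar R}) :=
  let chi_muY : set (borel Y) -> \bar R :=
    fun A => \int[coset_measure mu]_(t in A) (on_cosets chi t)%:E in
  forall C : set (borel Y * borel Z), measurable C ->
    pushforward lambda
      ((fun x => (y x, z x)) : borel X -> borel Y * borel Z) C =
    (chi_muY \x^ nu) C.

(* f is not required to be nonnegative: f (y x) >= 0 for lambda-almost all x
   because P takes nonnegative values. *)
Definition cross_sectionally_contoured
    (lambda : {measure set (borel X) -> \bar R}) (y : X -> Y)
    (P : set (borel X) -> \bar R) :=
  exists2 f : borel Y -> R, measurable_fun [set: borel Y] f &
    forall A : set (borel X), measurable A ->
      P A = \int[lambda]_(x in A) (f (y x))%:E.

End measures_on_space.

Definition independent_maps d d1 d2 (T : measurableType d)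
    (T1 : measurableType d1) (T2 : measurableType d2) (R : realType)
    (P : probability T R) (U : T -> T1) (V : T -> T2) :=
  forall (A : set T1) (B : set T2), measurable A -> measurable B ->
    P (U @^-1` A `&` V @^-1` B) = (P (U @^-1` A) * P (V @^-1` B))%E.

(* Main.v *)
From HB Require Import structures.
Require Import Defs.
From mathcomp Require Import all_boot all_order all_algebra.
From mathcomp Require Import all_classical all_reals all_analysis.
From mathcomp Require Import measurable_realfun.

Set Implicit Arguments.
Unset Strict Implicit.
Unset Printing Implicit Defensive.

Import Order.TTheory GRing.Theory Num.Theory.
Import numFieldNormedType.Exports.

Local Open Scope classical_set_scope.
Local Open Scope ring_scope.

(* Write x = h z' with y'(x) = h G0. Since z' = g(z') z(z'), we have
   y(x) = h g(z') G0, so that, for fixed z', y is a right translate of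
   y'. Under a right translation by g the measure chi(y) mu_Y(dy) is multiplied
   by 1 / Delta(g); hence the factorization of lambda along (y', z') shows that
   (y, z') carries lambda to the product of chi(y) mu_Y(dy) and of
   nu_Z'(dz') / Delta(g(z')). Comparing with the factorization along (y, z),
   where nu_Z has mass 1, the latter measure has mass 1 as well. Integrating
   the density f_Y(y), which does not involve z', over a rectangle then yields
   both the law of z' and its independence from y. *)

(** * Borel sets *)

Lemma open_borel (T : ptopologicalType) (A : set T) :
  open A -> measurable (A : set (borel T)).
Proof. exact: sub_sigma_algebra. Qed.

Lemma closed_borel (T : ptopologicalType) (A : set T) :
  closed A -> measurable (A : set (borel T)).
Proof.
move=> cA; rewrite -[A]setCK; apply: measurableC; apply: open_borel.
exact: closed_openC.
Qed.

Lemma continuous_borel (S T : ptopologicalType) (f : S -> T) :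
  continuous f -> measurable_fun [set: borel S] (f : borel S -> borel T).
Proof.
move=> /continuousP cf.
apply: (@measurability _ _ (borel S) (borel T) _ _ (@open T)) => // _ [A oA <-].
rewrite setTI; apply: open_borel; exact: cf.
Qed.

(** [R] carries its own sigma-algebra rather than that of [borel R]; it is generated by open
    intervals, whose preimages are open. *)
Lemma continuous_borel_real (R : realType) (S : ptopologicalType) (f : S -> R) :
  continuous f -> measurable_fun [set: borel S] (f : borel S -> R).
Proof.
move=> /continuousP cf; apply: (measurability _ (RGenOpens.measurableE R)).
move=> _ [_ [a [b ->]] <-]; rewrite setTI; apply: open_borel; apply: cf.
exact: interval_open.
Qed.

(** By local compactness every point lies in a base set with compact closure, and the base is
    countable. *)
Lemma second_countable_sigma_compact (T : topologicalType) :
  @second_countable T -> locally_compact [set: T] ->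
  exists2 K : (set T)^nat, forall n, compact (K n) & \bigcup_n K n = setT.
Proof.
move=> [B cB [oB nB]] lT.
have Bcov x : exists2 U, B U & U x /\ compact (closure U).
  have [V] := lT x I; rewrite withinET => nV [cV clV].
  have [U [BU Ux] UV] := nB x _ nV.
  exists U => //; split=> //; rewrite -precompactE.
  by apply: (precompact_subset UV); rewrite precompact_closed.
have [f fB] := pcard_surjP cB.
(* Base sets whose closure is not compact are replaced by the empty set. *)
exists (fun n => if `[< compact (closure (f n)) >]
                 then closure (f n) else set0).
  by move=> n; case: asboolP => [|_] //; exact: compact0.
rewrite -subTset => x _; have [U BU [Ux cU]] := Bcov x.
have [n _ fnU] := fB _ BU; exists n => //.
by rewrite fnU; case: asboolP => [_|//]; exact: subset_closure.
Qed.

(** * Cosets of a compact subgroup *)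

Section coset.
Variables (R : realType) (G : topologicalGroupType) (G0 : groupClosed G).
Hypothesis G0_compact : compact [set` G0].

Lemma lcoset_ofP (g h : G) :
  (lcoset_of G0 g = lcoset_of G0 h) <-> (g^-1 * h)%g \in G0.
Proof.
by split=> [/(@generic_quotient.eqmodP _ (lcoset_equiv G0))|gh]; last
  apply/(@generic_quotient.eqmodP _ (lcoset_equiv G0)).
Qed.

Lemma lcoset_of_repr (y : coset_space G0) : lcoset_of G0 (repr y) = y.
Proof. exact: reprK. Qed.

Lemma lcoset_of_continuous : continuous (lcoset_of G0).
Proof. exact: pi_continuous. Qed.

Lemma character_compact_subgroup (chi : G -> R) (h : G) :
  continuous_character chi -> h \in G0 -> chi h = 1.
Proof.
move=> [cchi chi_gt0 chiM].
(* If c maximizes chi on G0, then chi h * chi c = chi (h * c) <= chi c. *)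
have G0n : [set` G0] !=set0 by exists 1%g; exact: gpred1.
have [c cG0 cmax] := compact_EVT_max G0n G0_compact (continuous_subspaceT cchi).
have le1 g : g \in G0 -> chi g <= 1.
  move=> gG0; rewrite -(ler_pM2r (chi_gt0 c)) mul1r -chiM.
  by apply: cmax; rewrite inE/=; apply: gpredM => //; rewrite inE in cG0.
have chi1 : chi 1%g = 1.
  by apply: (mulfI (lt0r_neq0 (chi_gt0 1%g))); rewrite -chiM mulg1 mulr1.
move=> hG0; apply/eqP; rewrite eq_le le1//=.
have : chi h^-1%g <= 1 by rewrite le1// gpredV.
by rewrite -(ler_pM2l (chi_gt0 h)) -chiM mulgV chi1 mulr1.
Qed.

Lemma on_cosets_lcoset_of (chi : G -> R) (g : G) :
  continuous_character chi -> on_cosets chi (lcoset_of G0 g) = chi g.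
Proof.
move=> hchi; have [_ _ chiM] := hchi.
rewrite /on_cosets; set r := repr _.
have /lcoset_ofP rg : lcoset_of G0 g = lcoset_of G0 r by rewrite lcoset_of_repr.
rewrite -[r](mulVKg g) chiM.
by rewrite (character_compact_subgroup hchi rg) mulr1.
Qed.

Lemma on_cosets_continuous (chi : G -> R) :
  continuous_character chi ->
  continuous (on_cosets chi : coset_space G0 -> R).
Proof.
move=> hchi; apply/quotient_continuous.
have [cchi _ _] := hchi.
rewrite (_ : _ \o _ = chi)//.
by apply/funext => g /=; exact: on_cosets_lcoset_of.
Qed.

(** Writes the saturation as the product K G0, a continuous image of a compact set when K and G0 are
    compact. *)
Lemma lcoset_saturation (K : set G) :
  lcoset_of G0 @^-1` (lcoset_of G0 @` K) =
  (fun p : G * G => (p.1 * p.2)%g) @` (K `*` [set` G0]).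
Proof.
apply/seteqP; split=> [g [k Kk /lcoset_ofP kg]|_ [[k h] [/= Kk G0h] <-]].
  by exists (k, (k^-1 * g)%g) => //=; rewrite mulVKg.
by exists k => //; apply/lcoset_ofP; rewrite mulKg.
Qed.

Lemma lcoset_saturation_compact (K : set G) : compact K ->
  compact (lcoset_of G0 @^-1` (lcoset_of G0 @` K)).
Proof.
move=> cK; rewrite lcoset_saturation; apply: continuous_compact.
  exact/continuous_subspaceT/mulg_continuous.
exact: compact_setX.
Qed.

(** In the quotient topology closedness is tested on the preimage in G, which is compact and hence
    closed. This makes images of compact sets Borel in the coset space. *)
Lemma lcoset_image_closed (K : set G) : hausdorff_space G -> compact K ->
  closed (lcoset_of G0 @` K).
Proof.
move=> hG cK; rewrite -[X in closed X]setCK; apply: open_closedC.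
rewrite /open/= /quotient_open preimage_setC; apply: closed_openC.
apply: compact_closed => //.
exact: lcoset_saturation_compact.
Qed.

End coset.

(** * Measures *)

Section measure_constructions.
Local Open Scope ereal_scope.
Context (R : realType).

Lemma density_measure d (T : measurableType d) (mu : {measure set T -> \bar R})
    (f : T -> R) :
  measurable_fun setT f -> (forall x, 0 <= f x)%R ->
  exists m : {measure set T -> \bar R},
    forall A, m A = \int[mu]_(x in A) (f x)%:E.
Proof.
move=> mf f0; pose m0 A := \int[mu]_(x in A) (f x)%:E.
have m00 : m0 set0 = 0 by exact: integral_set0.
have m0_ge0 A : 0 <= m0 A by apply: integral_ge0 => x _; rewrite lee_fin.
have m0_add : semi_sigma_additive m0.
  apply: semi_sigma_additive_nng_induced => [|x]; last by rewrite lee_fin.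
  exact/measurable_EFinP.
pose P := isMeasure.Build _ _ _ m0 m00 m0_ge0 m0_add.
pose m : {measure set T -> \bar R} := HB.pack m0 P.
by exists m.
Qed.

Lemma pushforward_is_measure d d' (T : measurableType d)
    (T' : measurableType d') (mu : {measure set T -> \bar R}) (f : T -> T') :
  measurable_fun setT f ->
  exists m : {measure set T' -> \bar R}, forall A, m A = mu (f @^-1` A).
Proof. by move=> mf; unshelve eexists (pushforward mu f). Qed.

(** Moves sigma-finiteness into the type of the measure, where the measurability of section weights
    expects it. *)
Lemma sigma_finite_is_measure d (T : measurableType d)
    (mu : {measure set T -> \bar R}) :
  sigma_finite setT mu ->
  exists m : {sigma_finite_measure set T -> \bar R}, forall A, m A = mu A.
Proof.
move=> smu.
pose S := isSFinite.Build _ _ _ (Measure.sort mu)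
  (sfinite_measure_sigma_finite smu).
pose F := isSigmaFinite.Build _ _ _ (Measure.sort mu) smu.
pose m : {sigma_finite_measure set T -> \bar R} :=
  HB.pack_for (SigmaFiniteMeasure.type T R) (Measure.sort mu) S F.
by exists m.
Qed.

(** Otherwise all sets of a countable cover by sets of finite measure would be null. Such sets A
    serve below to cancel [mu A] from identities. *)
Lemma sigma_finite_positive_set d (T : measurableType d)
    (mu : {measure set T -> \bar R}) :
  sigma_finite setT mu -> mu setT != 0 ->
  exists2 A, measurable A & 0 < mu A < +oo.
Proof.
move=> [F FT mF] mu0; apply: contrapT => nA.
have F0 n : mu (F n) = 0.
  apply/eqP/negP => /negP Fn0; apply: nA; exists (F n); first exact: (mF n).1.
  by rewrite (mF n).2 andbT lt0e Fn0 measure_ge0.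
move/negP: mu0; apply; rewrite -measure_le0 FT.
apply: le_trans (measure_sigma_subadditive _ _ _ _) _ => //.
- by move=> n; exact: (mF n).1.
- by apply: bigcupT_measurable => n; exact: (mF n).1.
- exact: subset_refl.
- by rewrite eseries0.
Qed.

End measure_constructions.

(** * Right translation of a Haar measure *)

Section haar.
Local Open Scope ereal_scope.
Variables (R : realType) (G : topologicalGroupType) (G0 : groupClosed G).
Variables (mu : {measure set (borel G) -> \bar R}) (D chi : G -> R).
Hypothesis G_second_countable : @second_countable G.
Hypothesis G_locally_compact : locally_compact [set: G].
Hypothesis G_hausdorff : hausdorff_space G.
Hypothesis G0_compact : compact [set` G0].
Hypothesis mu_haar : left_haar_measure mu.
Hypothesis D_modulus : right_modulus mu D.
Hypothesis chi_character : continuous_character chi.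

Lemma compact_borel (K : set G) : compact K -> measurable (K : set (borel G)).
Proof. by move=> cK; apply: closed_borel; exact: compact_closed. Qed.

Lemma haar_sigma_finite : sigma_finite setT mu.
Proof.
have [K cK KT] :=
  second_countable_sigma_compact G_second_countable G_locally_compact.
have [_ muK _] := mu_haar.
by exists K => // n; split; [exact: compact_borel|exact: muK].
Qed.

Lemma right_translation_borel (g : G) :
  measurable_fun [set: borel G] ((fun h => h * g)%g : borel G -> borel G).
Proof.
apply: continuous_borel => h.
have pair_cvg : (fun k : G => (k, g)) @ h --> (h, g).
  by apply: cvg_pair; [exact: cvg_id|exact: cvg_cst].
exact: (cvg_comp _ _ pair_cvg (@mulg_continuous G (h, g))).
Qed.

(** The modulus is stated with direct images, while measurability and change of variables use
    preimages. *)
Lemma right_translate_image (A : set G) (g : G) :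
  [set (h * g)%g | h in A] = (fun h => (h * g^-1)%g) @^-1` A.
Proof.
apply/seteqP; split=> [_ [h Ah <-]/=|h /= Ah]; first by rewrite mulgK.
by exists (h * g^-1)%g => //; rewrite mulgVK.
Qed.

Lemma right_translate_measurable (A : set (borel G)) (g : G) : measurable A ->
  measurable ([set (h * g)%g | h in A] : set (borel G)).
Proof.
move=> mA; rewrite right_translate_image -[X in measurable X]setTI.
exact: right_translation_borel.
Qed.

(** Both facts come from the defining identity of D on a set of positive finite measure, the second
    by translating by g^-1 and back by g. Together they give D g > 0. *)
Lemma right_modulusV (g : G) : [/\ 0 <= D g & D g * D g^-1%g = 1]%R.
Proof.
have [_ _ mu0] := mu_haar.
have [A mA /andP[A0 Aoo]] := sigma_finite_positive_set haar_sigma_finite mu0.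
have Afin : mu A \is a fin_num by rewrite ge0_fin_numE.
have a0 : (0 < fine (mu A))%R by rewrite fine_gt0// A0 Aoo.
split.
  by rewrite -(pmulr_lge0 _ a0) -lee_fin EFinM fineK// -D_modulus.
have : (D g)%:E * ((D g^-1%g)%:E * mu A) = mu A.
  rewrite -!D_modulus//; last exact: right_translate_measurable.
  rewrite !right_translate_image invgK.
  by congr (mu _); apply/seteqP; split=> b /=; rewrite mulgVK.
rewrite -(fineK Afin) -!EFinM => -[/eqP].
by rewrite mulrA -subr_eq0 -{2}[fine _]mul1r -mulrBl mulf_eq0 (gt_eqF a0) orbF
  subr_eq0 => /eqP.
Qed.

(** Substituting h g for h contributes 1 / D g from the measure and, as chi h = chi (h g) / chi g,
    the factor 1 / chi g from the integrand. *)
Lemma integral_right_translate (A : set (borel G)) (g : G) : measurable A ->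
  \int[mu]_(h in (fun h : borel G => (h * g)%g) @^-1` A) (chi h)%:E =
  (1 / (chi g * D g))%:E * \int[mu]_(h in A) (chi h)%:E.
Proof.
move=> mA; have [cchi chi_gt0 chiM] := chi_character.
have [Dg1_ge0 _] := right_modulusV g^-1%g.
have [_ DgV] := right_modulusV g.
have Dg0 : D g != 0%R.
  by apply: contra_eq_neq DgV => ->; rewrite mul0r eq_sym oner_neq0.
have mchi B : measurable_fun B (fun h : borel G => (chi h)%:E).
  apply/measurable_EFinP/measurable_funTS; exact: continuous_borel_real.
have mr := right_translation_borel g.
have mrA : measurable ((fun h : borel G => (h * g)%g) @^-1` A).
  by rewrite -[X in measurable X]setTI; exact: mr.
have chi_ge0 h : 0 <= (chi h)%:E by rewrite lee_fin ltW.
have := @ge0_integral_pushforward _ _ _ _ _ _ mr mu A _ mA (mchi A)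
  (fun h _ => chi_ge0 h).
(* The preimage of B under right translation by g is B g^-1, so the image measure is mu scaled by D
   g^-1. *)
have -> :
    \int[pushforward mu (fun h => (h * g)%g : borel G)]_(h in A) (chi h)%:E =
    \int[mscale (NngNum Dg1_ge0) mu]_(h in A) (chi h)%:E.
  apply: eq_measure_integral => B mB _.
  rewrite /pushforward -[RHS]/((D g^-1%g)%:E * mu B) -D_modulus//.
  by rewrite right_translate_image invgK.
rewrite ge0_integral_mscale//=.
under [X in _ = X]eq_integral do rewrite chiM mulrC EFinM.
rewrite (@ge0_integralZl _ _ _ mu _ mrA _ (mchi _))//.
move=> E; have DVE : (D g)^-1%R = D g^-1%g.
  by apply: (mulfI Dg0); rewrite mulfV.
rewrite div1r invfM EFinM -muleA DVE E muleA -EFinM.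
by rewrite mulVf ?mul1e// gt_eqF.
Qed.

End haar.

(** * Densities on restricted and rescaled measures *)

Section density.
Local Open Scope ereal_scope.
Context (R : realType).

(** The restricted measure does not charge the complement of E, and on measurable subsets of E it
    agrees with mu. *)
Lemma ge0_integral_mrestr d (T : measurableType d)
    (mu : {measure set T -> \bar R}) (E A : set T) (mE : measurable E)
    (f : T -> \bar R) :
  measurable A -> measurable_fun A f -> (forall x, A x -> 0 <= f x) ->
  \int[mrestr mu mE]_(x in A) f x = \int[mu]_(x in A `&` E) f x.
Proof.
move=> mA mf f0.
have mEC : measurable (~` E) by exact: measurableC.
have E0 : mrestr mu mE (~` E) = 0 by rewrite /mrestr setICl measure0.
rewrite (@ge0_negligible_integral _ _ _ (mrestr mu mE) _ _ _ mEC mA mf f0 E0).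
rewrite setDE setCK; apply: eq_measure_integral => B mB BE.
by rewrite -[LHS]/(mu (B `&` E)) setIidl// => x /BE[].
Qed.

(** A nonnegative set function with density g forces g to be nonnegative almost everywhere, so the
    integration lemmas for nonnegative functions become available. *)
Lemma density_funepos d (T : measurableType d)
    (lambda : {measure set T -> \bar R}) (g : T -> \bar R)
    (P : set T -> \bar R) :
  measurable_fun setT g -> (forall A, measurable A -> 0 <= P A) ->
  (forall A, measurable A -> P A = \int[lambda]_(x in A) g x) ->
  forall A, measurable A -> P A = \int[lambda]_(x in A) (g^\+ x).
Proof.
move=> mg P0 PE A mA.
pose N := [set x | g x < 0].
have mN : measurable N.
  by rewrite -[N]setTI; exact: emeasurable_fun_infty_o.
(* On N = {g < 0} the value P N is minus the integral of the negative part; since P N >= 0, that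
   integral vanishes. *)
have gn0 : \int[lambda]_x g^\- x = 0.
  have -> : \int[lambda]_x g^\- x = \int[lambda]_(x in N) g^\- x.
    rewrite [RHS]integral_mkcond; congr (integral _ _ _).
    apply/funext => x; rewrite patchE; case: ifPn => // xN.
    rewrite funenegE; apply/max_idPr; rewrite leeNl oppe0 leNgt.
    by apply/negP => gx; move/negP: xN; apply; rewrite inE.
  apply/eqP; rewrite eq_le integral_ge0// andbT -oppe_ge0.
  have := P0 _ mN; rewrite PE// integralE.
  have -> : \int[lambda]_(x in N) g^\+ x = 0.
    apply: integral0_eq => x /ltW gx.
    by rewrite funeposE; apply/max_idPr.
  by rewrite add0e.
rewrite PE// integralE.
rewrite (_ : \int[lambda]_(x in A) g^\- x = 0) ?sube0//.
apply/eqP; rewrite eq_le integral_ge0// andbT -gn0.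
by apply: ge0_subset_integral => //; exact: measurable_funeneg.
Qed.

Section scale.
Context d d1 (T : measurableType d) (T1 : measurableType d1).
Variables (lambda : {measure set T -> \bar R}) (y : T -> T1) (E : set T).
Variable k : R.
Hypothesis my : measurable_fun setT y.
Hypothesis mE : measurable E.
Hypothesis k0 : (0 <= k)%R.
Hypothesis lambda_scale : forall A, measurable A ->
  lambda (y @^-1` A `&` E) = k%:E * lambda (y @^-1` A).

(** The images under y of lambda restricted to E and of k lambda agree, so they give the same
    integral to any nonnegative function of y. This passes from lambda to a measure whose density
    depends on y only. *)
Lemma ge0_integral_preimage_scale (A : set T1) (f : T1 -> \bar R) :
  measurable A -> measurable_fun setT f -> (forall t, 0 <= f t) ->
  \int[lambda]_(x in y @^-1` A `&` E) f (y x) =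
  k%:E * \int[lambda]_(x in y @^-1` A) f (y x).
Proof.
move=> mA mf f0.
have myA B : measurable B -> measurable (y @^-1` B).
  by move=> mB; rewrite -[X in measurable X]setTI; exact: my.
have mfy : measurable_fun setT (f \o y) by exact: measurableT_comp.
have mfA : measurable_fun A f by exact: measurable_funTS.
rewrite -(@ge0_integral_mrestr _ _ _ _ _ mE (f \o y) (myA _ mA)
  (measurable_funTS mfy) (fun x _ => f0 (y x))).
rewrite -(@ge0_integral_pushforward _ _ _ _ _ _ my _ A f)//.
rewrite -(@ge0_integral_pushforward _ _ _ _ _ _ my _ A f)//.
(* [m] is the image of lambda under y, bundled as a measure so that [mscale] applies to it. *)
have [m mE'] := pushforward_is_measure lambda my.
transitivity (\int[mscale (NngNum k0) m]_(x in A) f x).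
  apply: eq_measure_integral => B mB _.
  rewrite -[LHS]/(lambda (y @^-1` B `&` E)) lambda_scale//.
  by rewrite -[RHS]/(k%:E * m B) mE'.
have -> : \int[pushforward lambda y]_(x in A) f x = \int[m]_(x in A) f x.
  by apply: eq_measure_integral => B mB _; rewrite mE'.
by rewrite ge0_integral_mscale// => x _; exact: f0.
Qed.

End scale.
End density.

(** * The measure chi(y) mu_Y(dy) *)

Section coset_weight.
Local Open Scope ereal_scope.
Variables (R : realType) (G : topologicalGroupType) (G0 : groupClosed G).
Variables (mu : {measure set (borel G) -> \bar R}) (D chi : G -> R).
Hypothesis G_second_countable : @second_countable G.
Hypothesis G_locally_compact : locally_compact [set: G].
Hypothesis G_hausdorff : hausdorff_space G.
Hypothesis G0_compact : compact [set` G0].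
Hypothesis mu_haar : left_haar_measure mu.
Hypothesis D_modulus : right_modulus mu D.
Hypothesis chi_character : continuous_character chi.

Let Y := coset_space G0.

(** This is the local set function [chi_muY] of [factors_along], named so that both factorizations
    can be expressed with it. *)
Definition coset_weight : set (borel Y) -> \bar R :=
  fun A => \int[coset_measure mu]_(t in A) (on_cosets chi t)%:E.

Lemma lcoset_of_borel :
  measurable_fun [set: borel G] (lcoset_of G0 : borel G -> borel Y).
Proof. by apply: continuous_borel; exact: lcoset_of_continuous. Qed.

Lemma lcoset_preimage_borel (A : set (borel Y)) : measurable A ->
  measurable (lcoset_of G0 @^-1` A : set (borel G)).
Proof.
by move=> mA; rewrite -[X in measurable X]setTI; exact: lcoset_of_borel.
Qed.

Lemma character_borel : measurable_fun [set: borel G] (chi : borel G -> R).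
Proof. by apply: continuous_borel_real; case: chi_character. Qed.

Lemma character_ge0 g : (0 <= chi g)%R.
Proof. by rewrite ltW//; case: chi_character. Qed.

(** Transports the weight to G, where right translation and the modulus are available; chi is
    constant on cosets because it is 1 on G0. *)
Lemma coset_weightE (A : set (borel Y)) : measurable A ->
  coset_weight A = \int[mu]_(g in lcoset_of G0 @^-1` A) (chi g)%:E.
Proof.
move=> mA; rewrite /coset_weight /coset_measure.
have mchi : measurable_fun A (fun t : borel Y => (on_cosets chi t)%:E).
  apply/measurable_EFinP; apply: measurable_funTS; apply: continuous_borel_real.
  exact: on_cosets_continuous.
rewrite (ge0_integral_pushforward lcoset_of_borel mu mA mchi).
  by apply: eq_integral => g _ /=; rewrite on_cosets_lcoset_of.
by move=> t _; rewrite lee_fin; exact: character_ge0.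
Qed.

(** Right translation by g need not descend to left cosets, so the relation between A and B is
    expressed on their preimages in G. *)
Lemma coset_weight_right_translate (A B : set (borel Y)) (g : G) :
  measurable A -> measurable B ->
  (forall h, B (lcoset_of G0 h) <-> A (lcoset_of G0 (h * g)%g)) ->
  coset_weight B = (1 / (chi g * D g))%:E * coset_weight A.
Proof.
move=> mA mB BA; rewrite !coset_weightE//.
rewrite -(integral_right_translate (D := D))//; last first.
  exact: lcoset_preimage_borel.
by congr (integral _ _ _); apply/seteqP; split => h /= /BA.
Qed.

(** The saturation of K is compact: chi is bounded on it and its Haar measure is finite. *)
Lemma coset_weight_compact (K : set G) : compact K ->
  coset_weight (lcoset_of G0 @` K) < +oo.
Proof.
move=> cK; have cL := lcoset_saturation_compact G0_compact cK.
rewrite coset_weightE; last by apply: closed_borel; exact: lcoset_image_closed.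
(* The maximum of chi exists only on a nonempty set. *)
have [->|/set0P L0] := eqVneq (lcoset_of G0 @^-1` (lcoset_of G0 @` K)) set0.
  by rewrite integral_set0.
have [cchi _ _] := chi_character.
have [c _ cmax] := compact_EVT_max L0 cL (continuous_subspaceT cchi).
have mL := compact_borel G_hausdorff cL.
have [_ muK _] := mu_haar.
apply: (@le_lt_trans _ _ (\int[mu]_(g in lcoset_of G0 @^-1` (lcoset_of G0 @` K))
    (chi c)%:E)).
  apply: ge0_le_integral => //.
  - by move=> g _; rewrite lee_fin character_ge0.
  - by apply/measurable_EFinP/measurable_funTS; exact: character_borel.
  - by move=> g Lg; rewrite lee_fin cmax// inE.
rewrite integral_cst// lte_mul_pinfty//.
  by rewrite lee_fin character_ge0.
exact: muK.
Qed.

(** Sigma-finiteness comes from covering the coset space by images of the compact sets that exhaust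
    G. *)
Lemma coset_weight_measure :
  exists m : {sigma_finite_measure set (borel Y) -> \bar R},
    forall A, measurable A -> m A = coset_weight A.
Proof.
have [mG mGE] := density_measure mu character_borel character_ge0.
have [mY mYE] := pushforward_is_measure mG lcoset_of_borel.
have mYw A : measurable A -> mY A = coset_weight A.
  by move=> mA; rewrite mYE mGE coset_weightE.
have [K cK KT] :=
  second_countable_sigma_compact G_second_countable G_locally_compact.
have mK n : measurable (lcoset_of G0 @` K n : set (borel Y)).
  by apply: closed_borel; exact: lcoset_image_closed.
have sY : sigma_finite setT mY.
  exists (fun n => lcoset_of G0 @` K n).
    rewrite -image_bigcup KT; apply/esym; rewrite -subTset => t _.
    by exists (repr t) => //; exact: lcoset_of_repr.
  move=> n; split; first exact: mK.
  by rewrite mYw//; exact: coset_weight_compact.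
have [m mE] := sigma_finite_is_measure sY.
by exists m => A mA; rewrite mE mYw.
Qed.

End coset_weight.

(** * Orbital decompositions *)

Section orbital.
Variables (G : topologicalGroupType) (X : ptopologicalType).
Variables (act : G -> X -> X) (G0 : groupClosed G).
Hypothesis act_continuous : continuous_action act.
Variable Z : global_cross_section act.
Hypothesis Z_isotropy : forall z, (Z : set X) z -> isotropy act z = [set` G0].
Variables (y : X -> coset_space G0) (z : X -> Z).
Hypothesis yz : orbital_decomposition y z.

(** Two representatives of y x differ by an element of G0, which fixes z x. In particular x is
    determined by the pair (y x, z x). *)
Lemma orbital_decompositionK (x : X) (g : G) :
  y x = lcoset_of G0 g -> x = act g (set_val (z x)).
Proof.
have [_ actM _] := act_continuous.
have [h [xh ->]] := yz x => /lcoset_ofP/esym hg.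
have /= : isotropy act (set_val (z x)) (h^-1 * g)%g.
  by rewrite Z_isotropy//; exact: set_valP.
by rewrite /isotropy/= => e; rewrite -[g](mulVKg h) actM e.
Qed.

Lemma orbital_decomposition_act (t : Z) (g : G) :
  z (act g (set_val t)) = t /\ y (act g (set_val t)) = lcoset_of G0 g.
Proof.
have [act1 actM _] := act_continuous.
set x := act g _; have [h [xh yh]] := yz x.
have actV k w v : v = act k w -> w = act k^-1%g v.
  by move=> ->; rewrite -actM mulVg act1.
(* Both z x and t lie in Z and in the orbit of x, which Z meets in a single point. *)
have zt : z x = t.
  have [s [_ us]] := (cross_sectionP Z).1 x.
  apply: val_inj; rewrite -[LHS]us; last first.
    by split; [exact: set_valP|exists h^-1%g => //; apply/esym/(actV _ _ _ xh)].
  by apply: us; split; [exact: set_valP|exists g^-1%g => //; apply/esym/actV].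
split=> //; rewrite yh; apply/lcoset_ofP.
(* Both h and g carry t to x, so h^-1 g fixes t. *)
suff : [set` G0] (h^-1 * g)%g by [].
rewrite -(Z_isotropy (set_valP t)) /isotropy/= actM -/x.
by rewrite xh -actM mulVg act1 zt.
Qed.

Lemma orbital_decomposition_translate (x : X) (g h : G) :
  y x = lcoset_of G0 g -> y (act h x) = lcoset_of G0 (h * g)%g.
Proof.
have [_ actM _] := act_continuous.
move=> /orbital_decompositionK ->; rewrite -actM.
exact: (orbital_decomposition_act _ _).2.
Qed.

End orbital.

(** * Comparison of two cross sections *)

Section change_of_cross_section.
Local Open Scope ereal_scope.
Variables (R : realType) (G : topologicalGroupType) (X : ptopologicalType).
Variables (act : G -> X -> X) (G0 : groupClosed G).
Hypothesis G_second_countable : @second_countable G.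
Hypothesis G_locally_compact : locally_compact [set: G].
Hypothesis G_hausdorff : hausdorff_space G.
Hypothesis act_continuous : continuous_action act.
Hypothesis G0_compact : compact [set` G0].
Variables Z Z' : global_cross_section act.
Hypothesis Z_isotropy : forall z, (Z : set X) z -> isotropy act z = [set` G0].
Hypothesis Z'_isotropy : forall z, (Z' : set X) z -> isotropy act z = [set` G0].
Variables (y : X -> coset_space G0) (z : X -> Z).
Hypothesis yz_decomposition : orbital_decomposition y z.
Hypothesis y_measurable :
  measurable_fun [set: borel X] (y : borel X -> borel (coset_space G0)).
Variables (y' : X -> coset_space G0) (z' : X -> Z').
Hypothesis yz'_decomposition : orbital_decomposition y' z'.
Hypothesis yz'_bimeasurable : bimeasurable_decomposition y' z'.
Variables (lambda : {measure set (borel X) -> \bar R}) (chi D : G -> R).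
Variable mu : {measure set (borel G) -> \bar R}.
Hypothesis chi_character : continuous_character chi.
Hypothesis mu_haar : left_haar_measure mu.
Hypothesis D_modulus : right_modulus mu D.
Variable nu' : {measure set (borel Z') -> \bar R}.
Hypothesis lambda_factors' : factors_along y' z' lambda chi mu nu'.
Variable sel : X -> G.
Hypothesis sel_selection : forall x, lcoset_of G0 (sel x) = y x.

Let weight := coset_weight (G0 := G0) mu chi.
Let Delta g := (chi g * D g)%R.

Implicit Types (A : set (borel (coset_space G0))) (B : set (borel Z')).

Lemma z'_measurable : measurable_fun [set: borel X] (z' : borel X -> borel Z').
Proof.
have [myz _] := yz'_bimeasurable.
exact: (measurableT_comp measurable_snd myz).
Qed.

Lemma Delta_inv_ge0 g : (0 <= 1 / Delta g)%R.
Proof.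
rewrite divr_ge0// mulr_ge0//; first by rewrite character_ge0.
by have [] := right_modulusV G_second_countable G_locally_compact G_hausdorff
  mu_haar D_modulus g.
Qed.

Let rectangle (A : set (borel (coset_space G0))) (B : set (borel Z')) :
  set (borel X) := y @^-1` A `&` z' @^-1` B.

Lemma rectangle_measurable A B : measurable A -> measurable B ->
  measurable (rectangle A B).
Proof.
move=> mA mB; apply: measurableI.
  by rewrite -[X in measurable X]setTI; exact: y_measurable.
by rewrite -[X in measurable X]setTI; exact: z'_measurable.
Qed.

(** The rectangle is cut out by (y, z'); this is the same set in the coordinates (y', z'), in which
    lambda is a product. *)
Let image A B : set (borel (coset_space G0) * borel Z') :=
  (fun x => (y' x, z' x)) @` rectangle A B.

Lemma image_measurable A B : measurable A -> measurable B ->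
  measurable (image A B).
Proof.
move=> mA mB; have [_ myz] := yz'_bimeasurable.
by apply: myz; exact: rectangle_measurable.
Qed.

(* For t in Z', x = h t gives y x = h g(t) G0, so the section at t is a right
   translate of A. *)
Lemma ysection_image A B (t : Z') (h : G) :
  ysection (image A B) t (lcoset_of G0 h) <->
  B t /\ A (lcoset_of G0 (h * sel (set_val t))%g).
Proof.
have [zt yt] :=
  orbital_decomposition_act act_continuous Z'_isotropy yz'_decomposition t h.
have yht : y (act h (set_val t)) = lcoset_of G0 (h * sel (set_val t))%g.
  exact: (orbital_decomposition_translate act_continuous Z_isotropy
    yz_decomposition).
rewrite /ysection/=; split.
  rewrite inE => -[x [Ax Bx] [y'x z'x]].
  have xE : x = act h (set_val t).
    rewrite -z'x.
    exact: (orbital_decompositionK act_continuous Z'_isotropy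
      yz'_decomposition).
  by split; [rewrite -z'x|rewrite -yht -xE].
move=> [Bt At]; rewrite inE; exists (act h (set_val t)); last by rewrite zt yt.
by split => /=; rewrite ?yht ?zt.
Qed.

Lemma weight_ysection A B (t : Z') : measurable A -> measurable B -> B t ->
  weight (ysection (image A B) t) =
  (1 / Delta (sel (set_val t)))%:E * weight A.
Proof.
move=> mA mB Bt; apply: coset_weight_right_translate => //.
  by apply: measurable_ysection; exact: image_measurable.
by move=> h; rewrite ysection_image; split=> [[]|].
Qed.

Lemma weight_ysection0 A B (t : Z') : ~ B t ->
  weight (ysection (image A B) t) = 0.
Proof.
move=> Bt; have -> : ysection (image A B) t = set0.
  rewrite -subset0 => u; rewrite -(lcoset_of_repr u) => /ysection_image[].
  by move=> /Bt.
by rewrite /weight coset_weightE// preimage_set0 integral_set0.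
Qed.

(** In the coordinates (y', z') the product measure integrates the weights of the sections, and each
    section over B is a right translate of A. *)
Lemma lambda_rectangle A B : measurable A -> measurable B ->
  lambda (rectangle A B) =
  \int[nu']_(t in B) ((1 / Delta (sel (set_val t)))%:E * weight A).
Proof.
move=> mA mB.
(* The rectangle is the full preimage of its image because (y', z') is injective. *)
have -> : rectangle A B = (fun x => (y' x, z' x)) @^-1` image A B.
  apply/seteqP; split=> [x ABx|x [x1 ABx1 [y1 z1]]]; first by exists x.
  suff -> : x = x1 by [].
  have y'x1 : y' x1 = lcoset_of G0 (repr (y' x1)) by rewrite lcoset_of_repr.
  have K := orbital_decompositionK act_continuous Z'_isotropy yz'_decomposition.
  by rewrite (K _ _ y'x1) z1; apply: K; rewrite -y1.
have := lambda_factors' (image_measurable mA mB).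
rewrite /pushforward/= => ->; rewrite /product_measure2 [RHS]integral_mkcond.
(* Sections at points outside B are empty, so the integral reduces to B. *)
apply: eq_integral => t _; rewrite patchE; case: ifPn => tB /=.
  by rewrite -(weight_ysection mA mB)//; rewrite inE in tB.
rewrite -[RHS](@weight_ysection0 A B t)// => Bt.
by move/negP: tB; apply; rewrite inE.
Qed.

(* The sections of a measurable set have measurable weight, which gives the
   measurability of 1 / Delta without any regularity of D or of sel. *)
Lemma Delta_inv_measurable : weight setT != 0 ->
  measurable_fun [set: borel Z']
    (fun t : borel Z' => (1 / Delta (sel (set_val t)))%:E).
Proof.
move=> w0.
have [m mE] := coset_weight_measure G_second_countable G_locally_compact
  G_hausdorff G0_compact mu_haar chi_character.
have mT : m setT != 0 by rewrite mE.
have [A mA /andP[A0 Aoo]] := sigma_finite_positive_set (sigma_finiteT m) mT.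
have Afin : m A \is a fin_num by rewrite ge0_fin_numE.
have A1 : (fine (m A) != 0)%R by rewrite gt_eqF// fine_gt0// A0 Aoo.
(* For B = Z' the section at t weighs m A / Delta(g(t)); dividing by m A leaves 1 / Delta(g(t)). *)
have mI := image_measurable mA (@measurableT _ (borel Z')).
have := measurable_fun_ysection m mI.
move=> /(measurable_funeM (fine (m A))^-1%:E).
congr measurable_fun; apply/funext => t /=.
rewrite (mE _ (measurable_ysection _ mI)) -/weight weight_ysection//.
have -> : weight A = (fine (m A))%:E by rewrite fineK// mE.
by rewrite -!EFinM mulrCA mulVf// mulr1.
Qed.

Lemma lambda_rectangleE A B : weight setT != 0 ->
  measurable A -> measurable B ->
  lambda (rectangle A B) =
  (\int[nu']_(t in B) (1 / Delta (sel (set_val t)))%:E) * weight A.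
Proof.
move=> w0 mA mB; rewrite lambda_rectangle//.
have mDB := measurable_funTS (D := B) (Delta_inv_measurable w0).
rewrite (ge0_integralZr nu' mB mDB)//.
- by move=> t _; rewrite lee_fin Delta_inv_ge0.
- rewrite /weight coset_weightE//; apply: integral_ge0 => h _.
  by rewrite lee_fin (character_ge0 chi_character).
Qed.

End change_of_cross_section.

(** * The law of z' and its independence from y *)

(** The standardization of nu to mass 1 enters here: integrating the constant section weight over Z
    leaves it unchanged. *)
Lemma lambda_cylinder (R : realType) (G : topologicalGroupType)
    (X : ptopologicalType) (act : G -> X -> X) (G0 : groupClosed G)
    (Z : global_cross_section act) (y : X -> coset_space G0) (z : X -> Z)
    (lambda : {measure set (borel X) -> \bar R}) (chi : G -> R)
    (mu : {measure set (borel G) -> \bar R}) (nu : probability (borel Z) R)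
    (A : set (borel (coset_space G0))) :
  factors_along y z lambda chi mu nu -> measurable A ->
  lambda (y @^-1` A) = coset_weight mu chi A.
Proof.
move=> fact mA; have := fact (A `*` setT) (measurableX mA measurableT).
rewrite /pushforward (_ : _ @^-1` _ = y @^-1` A); last first.
  by apply/seteqP; split=> x /= => [[]|].
move=> ->; rewrite /product_measure2.
under eq_integral do rewrite /= in_ysectionX ?in_setT//.
rewrite -[RHS]mule1 -(probability_setT nu).
exact: (integral_cst nu measurableT).
Qed.

Theorem theorem3p3 (R : realType)
  (G : topologicalGroupType) (X : ptopologicalType) (act : G -> X -> X)
  (X_locally_compact : locally_compact [set: X])
  (X_hausdorff : hausdorff_space X)
  (G_second_countable : @second_countable G)
  (G_locally_compact : locally_compact [set: G])
  (G_hausdorff : hausdorff_space G)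
  (act_continuous : continuous_action act)
  (G0 : groupClosed G)
  (G0_compact : compact [set` G0])
  (Z Z' : global_cross_section act)
  (Z_isotropy : forall z, (Z : set X) z -> isotropy act z = [set` G0])
  (Z'_isotropy : forall z, (Z' : set X) z -> isotropy act z = [set` G0])
  (Z_locally_compact : locally_compact [set: Z])
  (Z'_locally_compact : locally_compact [set: Z'])
  (y : X -> coset_space G0) (z : X -> Z)
  (yz_decomposition : orbital_decomposition y z)
  (yz_bimeasurable : bimeasurable_decomposition y z)
  (y' : X -> coset_space G0) (z' : X -> Z')
  (yz'_decomposition : orbital_decomposition y' z')
  (yz'_bimeasurable : bimeasurable_decomposition y' z')
  (lambda : {measure set (borel X) -> \bar R})
  (chi : G -> R)
  (chi_character : continuous_character chi)
  (lambda_invariant : relatively_invariant act lambda chi)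
  (muG : {measure set (borel G) -> \bar R})
  (muG_haar : left_haar_measure muG)
  (nuZ : probability (borel Z) R)
  (nuZ' : {measure set (borel Z') -> \bar R})
  (lambda_factors : factors_along y z lambda chi muG nuZ)
  (lambda_factors' : factors_along y' z' lambda chi muG nuZ')
  (DeltaG : G -> R)
  (DeltaG_modulus : right_modulus muG DeltaG)
  (sel : X -> G)
  (sel_selection : forall x, lcoset_of G0 (sel x) = y x)
  (d : measure_display) (Omega : measurableType d)
  (Pr : probability Omega R) (x : {RV Pr >-> borel X})
  (x_contoured : cross_sectionally_contoured lambda y (distribution Pr x)) :
  let Delta g := chi g * DeltaG g in
  (forall B : set (borel Z'), measurable B ->
     pushforward Pr ((fun w => z' (x w)) : Omega -> borel Z') B =
     (\int[nuZ']_(t in B) (1 / Delta (sel (set_val t)))%:E)%E) /\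
  independent_maps Pr
    ((fun w => z' (x w)) : Omega -> borel Z')
    ((fun w => y (x w)) : Omega -> borel (coset_space G0)).
Proof.
move=> Delta.
have y_borel :
    measurable_fun [set: borel X] (y : borel X -> borel (coset_space G0)).
  exact: (measurableT_comp measurable_fst yz_bimeasurable.1).
have z'_borel := z'_measurable yz'_bimeasurable.
have [f mf fE] := x_contoured.
pose P := distribution Pr x.
have weightE (A : set (borel (coset_space G0))) : measurable A ->
    lambda (y @^-1` A) = coset_weight muG chi A.
  by move=> mA; exact: lambda_cylinder lambda_factors mA.
(* If the weight vanished, lambda would be zero, and so would the total mass of P, which has a
   density with respect to lambda. *)
have weight0 : coset_weight (G0 := G0) muG chi setT != 0.
  rewrite -weightE// preimage_setT; apply/eqP => lambda0.
  have := fE _ measurableT.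
  rewrite null_set_integral//.
    by rewrite probability_setT => /eqP; rewrite onee_eq0.
  by apply/measurable_EFinP; exact: measurableT_comp mf y_borel.
pose g : X -> \bar R := fun u => (f (y u))%:E.
pose kappa (B : set (borel Z')) :=
  (\int[nuZ']_(t in B) (1 / Delta (sel (set_val t)))%:E)%E.
have rectE (A : set (borel (coset_space G0))) (B : set (borel Z')) :
    measurable A -> measurable B ->
    lambda (y @^-1` A `&` z' @^-1` B) = (kappa B * coset_weight muG chi A)%E.
  move=> mA mB.
  exact: (lambda_rectangleE G_second_countable G_locally_compact G_hausdorff
    act_continuous G0_compact Z_isotropy Z'_isotropy yz_decomposition y_borel
    yz'_decomposition yz'_bimeasurable chi_character muG_haar DeltaG_modulus
    lambda_factors' sel_selection weight0).
have Delta_ge0 t : (0 <= (1 / Delta (sel (set_val t)))%:E :> \bar R)%E.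
  rewrite lee_fin; exact: (Delta_inv_ge0 G_second_countable G_locally_compact
    G_hausdorff chi_character muG_haar DeltaG_modulus).
have kappa_ge0 B : (0 <= kappa B)%E by exact: integral_ge0.
(* For a set A of positive finite weight, lambda of the preimage of A under y is [m A] by one
   factorization and [kappa setT * m A] by the other. *)
have kappaT : kappa setT = 1%E.
  have [m mE] := coset_weight_measure G_second_countable G_locally_compact
    G_hausdorff G0_compact muG_haar chi_character.
  have mT : (m setT != 0)%E by rewrite mE.
  have [A mA /andP[A0 Aoo]] := sigma_finite_positive_set (sigma_finiteT m) mT.
  have := rectE A setT mA measurableT.
  rewrite preimage_setT setIT weightE// -mE// => kE.
  have Afin : m A \is a fin_num by rewrite ge0_fin_numE.
  have An0 : (m A != 0)%E by rewrite gt_eqF.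
  by rewrite -[LHS]mule1 -(divee Afin An0) muleA -kE.
have kappa_fin B : measurable B -> kappa B \is a fin_num.
  move=> mB; rewrite ge0_fin_numE//; apply: le_lt_trans (ltry 1).
  rewrite -kappaT; apply: ge0_subset_integral => //.
  exact: (Delta_inv_measurable G_second_countable G_locally_compact G_hausdorff
    act_continuous G0_compact Z_isotropy Z'_isotropy yz_decomposition y_borel
    yz'_decomposition yz'_bimeasurable chi_character muG_haar DeltaG_modulus
    sel_selection weight0).
(* Intersecting with the event that z' lies in B scales lambda by [kappa B] on preimages under y;
   the density is a function of y, so P scales in the same way. *)
have joint (A : set (borel (coset_space G0))) (B : set (borel Z')) :
    measurable A -> measurable B ->
    P (y @^-1` A `&` z' @^-1` B) = (kappa B * P (y @^-1` A))%E.
  move=> mA mB.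
  have mA' : measurable (y @^-1` A : set (borel X)).
    by rewrite -[X in measurable X]setTI; exact: y_borel.
  have mB' : measurable (z' @^-1` B : set (borel X)).
    by rewrite -[X in measurable X]setTI; exact: z'_borel.
  have mg : measurable_fun [set: borel X] g.
    by apply/measurable_EFinP; exact: measurableT_comp mf y_borel.
  have PE C : measurable C -> P C = (\int[lambda]_(u in C) g^\+ u)%E.
    apply: density_funepos mg _ fE C => C' _.
    exact: (measure_ge0 (distribution Pr x)).
  rewrite (PE _ mA') (PE _ (measurableI _ _ mA' mB')).
  have fp0 : (0 <= fine (kappa B))%R by rewrite fine_ge0.
  have := @ge0_integral_preimage_scale _ _ _ (borel X)
    (borel (coset_space G0)) lambda y (z' @^-1` B) _ y_borel mB' fp0.
  rewrite fineK ?kappa_fin// => scale.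
  have gE : (g^\+ = (EFin \o f)^\+ \o y)%E by rewrite -funepos_comp.
  rewrite gE; apply: scale => //.
  - by move=> C mC; rewrite -[LHS]/(lambda (_ `&` _)) rectE// weightE.
  - by apply: measurable_funepos; exact/measurable_EFinP.
(* Taking A to be the whole coset space identifies [kappa] with the law of z', which turns [joint]
   into the product formula. *)
have marginal (B : set (borel Z')) : measurable B -> P (z' @^-1` B) = kappa B.
  move=> mB; have := joint setT B measurableT mB.
  have PT : P setT = 1%E by exact: (probability_setT (distribution Pr x)).
  by rewrite preimage_setT setTI PT mule1.
split=> [B mB|B A mB mA]; first exact: marginal.
by rewrite setIC; have := joint A B mA mB; rewrite -marginal.
Qed.
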